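(* (First variation of polarity.) Let $u(t,x)\in C^2(\mathbb R\times(\mathbb R^n\setminus\{0\}))$ with $u_t(\cdot)=u(t,\cdot)\in\mathcal S_2(\mathbb R^n)$ for each $t$. Let $w_t=w(t,\cdot)=(u_t)^\circ$ be the fiberwise polar. Then for any $t$ and any $y$ such that $w_t$ is not linear on $[0,y]$, $$\left(\frac{\partial}{\partial t}\log w\right)(t,y)=-\left(\frac{\partial}{\partial t}\log u\right)(t,\nabla^\circ w(t,y)).$$
   Context: $\mathrm{Cvx}_0(\mathbb R^n)$ is the set of convex lower semi-continuous $f:\mathbb R^n\to[0,+\infty]$ with $f(0)=0$; $\mathrm{dom}(f)=\{f<\infty\}$. The polar of $f$ is $f^\circ(y)=\inf\{c\ge0:\langle x,y\rangle\le1+cf(x)\ \forall x\in\mathbb R^n\}$. $\mathcal S_1(\mathbb R^n)$ is the class of $f\in\mathrm{Cvx}_0(\mathbb R^n)$ that are finite everywhere, continuously differentiable on $\mathbb R^n\setminus\{0\}$ and strictly convex (the graph contains no segment). $\mathcal S_2(\mathbb R^n)\subset\mathcal S_1(\mathbb R^n)$ is the subclass of functions twice continuously differentiable on $\mathbb R^n\setminus\{0\}$ with $\nabla^2f(x)>0$ for all $x\ne0$. The polar subdifferential at $x\in\mathrm{dom}(f)$ is $\partial^\circ f(x)=\{y\in\mathrm{dom}(f^\circ): f^\circ(y)f(x)=\langle x,y\rangle-1\}$; if it is a single point $\{y\}$, $f$ is called polar differentiable at $x$ and $\nabla^\circ f(x)=y$. Here $\nabla^\circ w(t,y)$ is the polar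 gradient of $w_t$ at $y$, i.e. in the space variable (it exists for the $y$ considered). A function $g$ is linear on $[0,v]$ if it is finite there and $g(sv)=s\,g(v)$ for all $s\in[0,1]$ (so $y=0$ is excluded in the claim). *)

(* Defs.v *)
From HB Require Import structures.
From mathcomp Require Import all_boot all_order all_algebra.
From mathcomp Require Import all_classical all_reals all_analysis.

Set Implicit Arguments.
Unset Strict Implicit.
Unset Printing Implicit Defensive.

Import Order.TTheory GRing.Theory Num.Theory.
Import numFieldNormedType.Exports.

Local Open Scope classical_set_scope.
Local Open Scope ring_scope.

Definition dotp (R : realType) (n : nat) (x y : 'rV[R]_n) : R :=
  \sum_(i < n) x 0 i * y 0 i.

(* [C_on k U f]: f is of class C^k on the open set U.  In finite dimension,
   continuity of x |-> 'd f x amounts to that of 'D_v f for every v. *)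
Fixpoint C_on (R : realType) (V : normedModType R) (k : nat) (U : set V)
    (f : V -> R) : Prop :=
  match k with
  | 0%N => forall x, U x -> {for x, continuous f}
  | k'.+1 => (forall x, U x -> differentiable f x) /\
             (forall v, C_on k' U ('D_v f))
  end.

Definition hessian (R : realType) (n : nat) (f : 'rV[R]_n -> R)
    (x : 'rV[R]_n) : 'M[R]_n :=
  \matrix_(i, j) 'D_(delta_mx 0 i) ('D_(delta_mx 0 j) f) x.

Definition posdef (R : realType) (n : nat) (A : 'M[R]_n) : Prop :=
  A^T = A /\ forall v : 'rV[R]_n, v != 0 -> 0 < (v *m A *m v^T) 0 0.

Local Open Scope ereal_scope.

Section ConvexFunctions.
Context {R : realType} {n : nat}.
Implicit Types (f g : 'rV[R]_n -> \bar R) (x y v : 'rV[R]_n).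

Definition dom f : set 'rV[R]_n := [set x | f x < +oo].

(* For nonnegative functions no +oo - oo occurs on the right-hand side, and
   0 * +oo = 0 makes the endpoint cases trivial. *)
Definition convex_ereal f : Prop :=
  forall x y (s : R), (0 <= s <= 1)%R ->
    f (s *: x + (1 - s) *: y)%R <= s%:E * f x + (1 - s)%:E * f y.

Definition Cvx0 f : Prop :=
  [/\ forall x, 0 <= f x, convex_ereal f, lower_semicontinuous f & f 0%R = 0].

(* The infimum of the empty set is +oo.  The value of c * f x for c = 0 and
   f x = +oo is irrelevant to the infimum. *)
Definition polar f : 'rV[R]_n -> \bar R := fun y =>
  ereal_inf [set c%:E | c in [set c : R | (0 <= c)%R /\
    forall x, (dotp x y)%:E <= 1 + c%:E * f x]].

(* Among convex functions this is the usual strict convexity. *)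
Definition graph_contains_no_segment f : Prop :=
  forall x y, x <> y -> f x < +oo -> f y < +oo ->
    ~ (forall s : R, (0 <= s <= 1)%R ->
         f (s *: x + (1 - s) *: y)%R = s%:E * f x + (1 - s)%:E * f y).

Definition S1 f : Prop :=
  [/\ Cvx0 f, forall x, f x < +oo,
      C_on 1 [set x : 'rV[R]_n | x != 0%R] (fine \o f) &
      graph_contains_no_segment f].

Definition S2 f : Prop :=
  [/\ S1 f,
      C_on 2 [set x : 'rV[R]_n | x != 0%R] (fine \o f) &
      forall x, x != 0%R -> posdef (hessian (fine \o f) x)].

Definition polar_subdiff f x : set 'rV[R]_n :=
  [set y | dom (polar f) y /\ polar f y * f x = (dotp x y - 1)%:E].

Definition polar_differentiable f x : Prop :=
  dom f x /\ exists y, polar_subdiff f x = [set y].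

(* Meaningful only where f is polar differentiable. *)
Definition polar_gradient f x : 'rV[R]_n := xget 0%R (polar_subdiff f x).

Definition linear_on_segment g v : Prop :=
  g v \is a fin_num /\
  forall s : R, (0 <= s <= 1)%R -> g (s *: v)%R = s%:E * g v.

End ConvexFunctions.

(* Main.v *)
Require Import Defs.
From HB Require Import structures.
From mathcomp Require Import all_boot all_order all_algebra.
From mathcomp Require Import all_classical all_reals all_analysis.
From mathcomp Require Import ring lra.

Set Implicit Arguments.
Unset Strict Implicit.
Unset Printing Implicit Defensive.

Import Order.TTheory GRing.Theory Num.Theory.
Import numFieldNormedType.Exports.

Local Open Scope classical_set_scope.
Local Open Scope ring_scope.

(** Up to truncation at 0, the polar w_t(y) is the supremum over x of
    q(t, x) = (<x, y> - 1) / u_t(x). If the supremum is not attained, then it is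
    approached only as x goes to infinity, where the -1 is negligible, and w_t
    is linear on [0, y]. Otherwise strict convexity makes the maximizer x0
    unique, and w_t° = u_t identifies it with the polar gradient of w_t at y.
    The formula is then the envelope theorem for log w = max_x log q: for s near
    t the function q(s, .) has a maximizer x_s near x0, and comparing q(s, .)
    with q(t, .) at x0 and at x_s squeezes log w_s(y) - log w_t(y) between
    -(log u_s - log u_t) at x0 and at x_s; the mean value theorem concludes. *)

(** * Inner product estimates and compact annuli *)

Section DotProduct.
Context {R : realType} {n : nat}.
Implicit Types (x y z p : 'rV[R]_n) (a : R).

Lemma dotpDl x y z : dotp (x + y) z = dotp x z + dotp y z.
Proof. by rewrite -big_split; apply: eq_bigr => i _; rewrite !mxE mulrDl. Qed.

Lemma dotpZl a x y : dotp (a *: x) y = a * dotp x y.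
Proof. by rewrite mulr_sumr; apply: eq_bigr => i _; rewrite !mxE mulrA. Qed.

Lemma dotpC x y : dotp x y = dotp y x.
Proof. by apply: eq_bigr => i _; rewrite mulrC. Qed.

Lemma dotpZr a x y : dotp x (a *: y) = a * dotp x y.
Proof. by rewrite dotpC dotpZl dotpC. Qed.

Lemma dotp0l x : dotp 0 x = 0.
Proof. by rewrite -(scale0r 0) dotpZl mul0r. Qed.

Lemma dotp_gt0 x : x != 0 -> 0 < dotp x x.
Proof.
move=> x0; have [i xi0] : exists i, x 0 i != 0.
  apply: contrapT => /forallNP x_eq0; case/eqP: x0; apply/rowP => i.
  by rewrite mxE; apply/eqP; apply: contrapT => /negP; exact: x_eq0.
rewrite /dotp (bigD1 i)//= ltr_pwDl//; first by rewrite -expr2 exprn_even_gt0.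
by apply: sumr_ge0 => j _; rewrite -expr2 sqr_ge0.
Qed.

Lemma le_coord_norm x i : `|x 0 i| <= `|x|.
Proof.
rewrite [X in _ <= X]mx_normrE.
exact: (le_bigmax _ (fun ij => `|x ij.1 ij.2|) (0, i)).
Qed.

Lemma dotp_le_norm y : exists2 C : R, 0 < C & forall x, dotp x y <= C * `|x|.
Proof.
(* The norm is the max norm, so the coordinates of [y] sum to a bound; the added 1 keeps the
   constant positive when [y = 0]. *)
exists (1 + \sum_(i < n) `|y 0 i|) => [|x].
  by rewrite ltr_pwDl// sumr_ge0.
rewrite mulrDl mul1r mulr_suml ler_wpDl// ler_sum// => i _.
rewrite (le_trans (ler_norm _))// normrM mulrC ler_wpM2l//.
exact: le_coord_norm.
Qed.

Lemma dotp_continuous y : continuous (fun x => dotp x y).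
Proof.
apply: continuous_big => [|i _ x]; first exact: add_continuous.
apply: (@continuousM _ _ (fun z : 'rV[R]_n => z 0 i) (cst (y 0 i)) x).
  exact: coord_continuous.
exact: cst_continuous.
Qed.

Lemma compact_annulus_at p (a b : R) :
  compact [set x : 'rV[R]_n | a <= `|x - p| <= b].
Proof.
apply: bounded_closed_compact.
  exists (`|p| + b); split; first exact: num_real.
  move=> M bM x /= /andP[_ xb]; rewrite -(subrK p x).
  rewrite (le_trans (ler_normD _ _))//.
  by rewrite ltW// (le_lt_trans _ bM)// addrC lerD2l.
rewrite (_ : [set _ | _] =
    (fun x : 'rV[R]_n => `|x - p|) @^-1` [set r | a <= r <= b])//.
apply: preimage_closed => [x _|].
  apply: continuous_comp; last exact: norm_continuous.
  apply: (@continuousB _ _ _ id (cst p) x).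
    exact: cvg_id.
  exact: cst_continuous.
rewrite (_ : [set _ | _] = [set` `[a, b]]); first exact: itv_closed.
by apply/seteqP; split=> r /=; rewrite in_itv.
Qed.

Lemma compact_annulus (a b : R) : compact [set x : 'rV[R]_n | a <= `|x| <= b].
Proof.
have := compact_annulus_at (p := 0) (a := a) (b := b).
by under eq_set do rewrite subr0.
Qed.

End DotProduct.

(** * Constants admissible in the infimum defining the polar *)

Section Feasible.
Context {R : realType} {n : nat}.
Implicit Types (f : 'rV[R]_n -> R) (x y : 'rV[R]_n) (b c : R).

Definition polar_feasible f y c :=
  0 <= c /\ forall x, dotp x y <= 1 + c * f x.

Lemma polar_le f y c : polar_feasible f y c ->
  (polar (fun x => (f x)%:E) y <= c%:E)%E.
Proof.
by move=> [c0 fc]; apply: ereal_inf_lbound; exists c => //; split.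
Qed.

Lemma polar_ge f y b : (forall c, polar_feasible f y c -> b <= c) ->
  (b%:E <= polar (fun x => (f x)%:E) y)%E.
Proof.
move=> lb; apply: le_ereal_inf_tmp => _ [c [c0 fc] <-].
by rewrite lee_fin; apply: lb; split.
Qed.

Lemma polar_lt_feasible f y b : (polar (fun x => (f x)%:E) y < b%:E)%E ->
  exists2 c, polar_feasible f y c & c < b.
Proof.
rewrite ltNge => /negP lt_b; apply: contrapT => /forall2NP nofeas.
apply: lt_b; apply: polar_ge => c fc; rewrite leNgt; apply/negP => cb.
by case: (nofeas c).
Qed.

(** The infimum is attained because feasibility is a closed condition on [c]: a violation at some
    [x] would persist for slightly larger constants, yet every constant above the infimum is
    feasible. *)
Lemma polar_feasibleP f y c : (forall x, 0 <= f x) ->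
  polar (fun x => (f x)%:E) y = c%:E -> polar_feasible f y c.
Proof.
move=> f0 fE; split.
  by rewrite -lee_fin -fE; apply: polar_ge => ? [].
move=> x; rewrite leNgt; apply/negP => ltx.
have cE b : c < b -> dotp x y <= 1 + b * f x.
  rewrite -lte_fin -fE => /polar_lt_feasible[c' [c'0 /(_ x) fc'] /ltW c'b].
  by rewrite (le_trans fc')// lerD2l ler_wpM2r.
have [fx0|fx_neq0] := eqVneq (f x) 0.
  by have := cE (c + 1); rewrite ltrDl fx0 => /(_ ltr01); nra.
have fx_gt0 : 0 < f x by rewrite lt_def fx_neq0 f0.
(* The inequality at [x] becomes an equality at [c + d], so it still fails at [c + d / 2]. *)
pose d := (dotp x y - 1 - c * f x) / f x.
have dE : d * f x = dotp x y - 1 - c * f x by rewrite divfK.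
have d0 : 0 < d by rewrite divr_gt0//; lra.
by have := cE (c + d / 2) ltac:(lra); nra.
Qed.

(** Optimality certificate: where [f x > 0], equality at the single point [x] bounds every feasible
    constant below by [c]. *)
Lemma polar_attained_eq f y c x : polar_feasible f y c ->
  0 < f x -> dotp x y - 1 = c * f x -> polar (fun x => (f x)%:E) y = c%:E.
Proof.
move=> fc fx0 xc; apply/le_anti; rewrite polar_le//=; apply: polar_ge => b [_].
by move=> /(_ x); rewrite -lerBlDl xc ler_pM2r.
Qed.

Lemma polar_at0 f : polar (fun x => (f x)%:E) 0 = 0%E.
Proof.
apply/le_anti/andP; split; last by apply: polar_ge => ? [].
by apply: polar_le; split=> // x; rewrite dotpC dotp0l mul0r addr0.
Qed.

End Feasible.

(** * Functions of class [S1]: growth, attainment of the polar, bipolarity *)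

Section S1Theory.
Context {R : realType} {n : nat} {f : 'rV[R]_n -> R}.
Hypothesis fS1 : S1 (fun x => (f x)%:E).
Implicit Types (x y z : 'rV[R]_n) (s : R).

Lemma S1_at0 : f 0 = 0.
Proof. by case: fS1 => -[_ _ _ [->]]. Qed.

Lemma S1_ge0 x : 0 <= f x.
Proof. by case: fS1 => -[f0 _ _ _ _ _ _]; rewrite -lee_fin. Qed.

Lemma S1_convex s x y : 0 <= s <= 1 ->
  f (s *: x + (1 - s) *: y) <= s * f x + (1 - s) * f y.
Proof. by case: fS1 => -[_ cf _ _ _ _ _] s01; rewrite -lee_fin; exact: cf. Qed.

Lemma S1_scale s x : 0 <= s <= 1 -> f (s *: x) <= s * f x.
Proof.
by move=> /(@S1_convex _ x 0); rewrite scaler0 addr0 S1_at0 mulr0 addr0.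
Qed.

Lemma S1_no_affine_segment x y : x <> y ->
  ~ (forall s, 0 <= s <= 1 ->
       f (s *: x + (1 - s) *: y) = s * f x + (1 - s) * f y).
Proof.
case: fS1 => _ _ _ nseg xy /= fxy.
by apply: (nseg x y xy (ltry _) (ltry _)) => s /fxy /= ->.
Qed.

(** A zero at [x] would force [f] to vanish on the whole segment from 0 to [x], which strict
    convexity forbids. *)
Lemma S1_gt0 x : x != 0 -> 0 < f x.
Proof.
move=> x0; rewrite lt_def S1_ge0 andbT; apply/eqP => fx0.
apply: (@S1_no_affine_segment x 0); first exact/eqP.
move=> s s01; rewrite scaler0 addr0 S1_at0 fx0 !mulr0 addr0.
by apply/le_anti; rewrite S1_ge0 andbT (le_trans (S1_scale _ s01))// fx0 mulr0.
Qed.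

Lemma S1_differentiable x : x != 0 -> differentiable f x.
Proof. by case: fS1 => _ _ [df _] _ x0; exact: df. Qed.

Lemma S1_continuous x : x != 0 -> {for x, continuous f}.
Proof. by move=> /S1_differentiable; exact: differentiable_continuous. Qed.

Lemma S1_quotient_continuous y x : x != 0 ->
  {for x, continuous (fun z => (dotp z y - 1) / f z)}.
Proof.
move=> x0.
apply: (@continuousM _ _ (fun z => dotp z y - 1) (fun z => (f z)^-1) x).
  apply: (@continuousB _ _ _ (fun z => dotp z y) (cst 1) x).
    exact: dotp_continuous.
  exact: cst_continuous.
apply: (@continuousV _ _ f x); first by rewrite gt_eqF// S1_gt0.
exact: S1_continuous.
Qed.

(** Take for [m] the minimum of [f] on the unit sphere and scale by convexity from 0. The sphere is
    empty only when no vector has norm at least 1. *)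
Lemma S1_growth : exists2 m : R, 0 < m & forall x, 1 <= `|x| -> m * `|x| <= f x.
Proof.
have [S0|S0] := pselect ([set x : 'rV[R]_n | 1 <= `|x| <= 1] !=set0);
  last first.
  exists 1 => // x x1; exfalso; apply: S0.
  by exists (`|x|^-1 *: x); rewrite /= normrZV ?lexx// unitfE; lra.
have [|c /set_mem /= c1 cmin] :=
    EVT_min_rV S0 (@compact_annulus R n 1 1) (f := f).
  apply: continuous_in_subspaceT => x /set_mem /= x1.
  by apply: S1_continuous; rewrite -normr_gt0; lra.
exists (f c); first by rewrite S1_gt0// -normr_gt0; lra.
move=> x x1; have x0 : 0 < `|x| by lra.
rewrite -ler_pdivlMr// mulrC.
apply: (le_trans (cmin _ _)); last first.
  by apply: S1_scale; rewrite invr_ge0 ltW//= invf_le1.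
by rewrite inE /= normrZV ?lexx// unitfE gt_eqF.
Qed.

(** Near 0 the product [dotp x y] is below 1 and every [c >= 0] works. What is left of the ball is a
    compact annulus avoiding 0, where the quotient has a maximum; [c] is this maximum truncated at
    0. *)
Lemma S1_feasible_on_ball y (M : R) : exists c, [/\ 0 <= c,
  forall x, `|x| <= M -> dotp x y <= 1 + c * f x &
  c = 0 \/ exists2 x, x != 0 & dotp x y - 1 = c * f x].
Proof.
have [C C0 dotC] := dotp_le_norm y.
pose K := [set x : 'rV[R]_n | C^-1 <= `|x| <= M].
have K_neq0 x : K x -> x != 0.
  move=> /= /andP[+ _]; rewrite -normr_gt0; apply: lt_le_trans.
  by rewrite invr_gt0.
have smallP c x : 0 <= c -> `|x| <= M -> ~ K x -> dotp x y <= 1 + c * f x.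
  move=> c0 xM nKx; have xC : `|x| < C^-1.
    by rewrite ltNge; apply/negP => Cx; apply: nKx; rewrite /K /= Cx.
  rewrite (le_trans (dotC x))// -(mulfV (lt0r_neq0 C0)) ler_wpDr//.
    by rewrite mulr_ge0// S1_ge0.
  by rewrite ler_pM2l// ltW.
pose q x := (dotp x y - 1) / f x.
have [K0|K0] := pselect (K !=set0); last first.
  exists 0; split=> // [x xM|]; last by left.
  by apply: smallP => // Kx; apply: K0; exists x.
have [|x1 /set_mem Kx1 x1max] :=
    EVT_max_rV K0 (@compact_annulus R n _ _) (f := q).
  apply: continuous_in_subspaceT => x /set_mem /K_neq0.
  exact: S1_quotient_continuous.
have qE x c : K x -> q x <= c -> dotp x y <= 1 + c * f x.
  by move=> /K_neq0 /S1_gt0 fx0; rewrite ler_pdivrMr// lerBlDl.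
exists (Num.max 0 (q x1)); split=> [|x xM|].
- by rewrite le_max lexx.
- have [Kx|nKx] := pselect (K x).
    by apply: qE => //; rewrite le_max x1max ?orbT// inE.
  by apply: smallP => //; rewrite le_max lexx.
- have [q0|q0] := leP (q x1) 0; [by left|right].
  exists x1; first exact: K_neq0.
  by rewrite divfK// gt_eqF// S1_gt0// K_neq0.
Qed.

(** Outside the unit ball, the linear growth of [f] dominates the linear bound on [dotp x y]. *)
Lemma S1_polar_fin y :
  exists2 c, polar (fun x => (f x)%:E) y = c%:E & polar_feasible f y c.
Proof.
suff [c fc] : exists c, polar_feasible f y c.
  have fin : polar (fun x => (f x)%:E) y \is a fin_num.
    rewrite ge0_fin_numE; first by rewrite (le_lt_trans (polar_le fc))// ltry.
    by apply: polar_ge => ? [].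
  exists (fine (polar (fun x => (f x)%:E) y)); first by rewrite fineK.
  by apply: polar_feasibleP; [exact: S1_ge0|rewrite fineK].
have [m m0 fm] := S1_growth; have [C C0 dotC] := dotp_le_norm y.
have [c [c0 fc _]] := S1_feasible_on_ball y 1.
exists (Num.max (C / m) c); split=> [|x]; first by rewrite le_max c0 orbT.
have [x1|/ltW x1] := leP `|x| 1.
  by rewrite (le_trans (fc x x1))// lerD2l ler_wpM2r ?S1_ge0// le_max lexx orbT.
rewrite (le_trans (dotC x))// ler_wpDl//.
rewrite (@le_trans _ _ (C / m * f x))//; last first.
  by rewrite ler_wpM2r ?S1_ge0// le_max lexx.
by rewrite -mulrA ler_pM2l// ler_pdivlMl// fm.
Qed.

Lemma S1_polar_gt0 y : y != 0 -> (0 < polar (fun x => (f x)%:E) y)%E.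
Proof.
(* The test vector has product 2 with [y], which rules out the constant 0. *)
move=> /dotp_gt0 yy0.
have [c -> [c0 /(_ ((2 / dotp y y) *: y))]] := S1_polar_fin y.
rewrite dotpZl divfK ?gt_eqF// lte_fin lt_def c0 andbT => fc.
by apply/eqP => c_eq0; rewrite c_eq0 mul0r addr0 in fc; lra.
Qed.

(* If the supremum of [(<x,y> - 1) / f x] were only approached at infinity, it
   would scale linearly along [0, y], since the term -1 is negligible there. *)
Lemma S1_polar_attained y : ~ linear_on_segment (polar (fun x => (f x)%:E)) y ->
  exists x c, [/\ x != 0, 0 < c, polar (fun x => (f x)%:E) y = c%:E,
    polar_feasible f y c & dotp x y - 1 = c * f x].
Proof.
move=> nlin; have [c cE feas_c] := S1_polar_fin y.
have [c0 fc] := feas_c.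
have [s s01 ns] : exists2 s : R, 0 <= s <= 1 &
    polar (fun x => (f x)%:E) (s *: y) <> (s * c)%:E.
  apply: contrapT => /forall2NP lin; apply: nlin; split; first by rewrite cE.
  by move=> s s01; rewrite cE -EFinM; case: (lin s) => // /contrapT.
have [b bE [b0 fb]] := S1_polar_fin (s *: y).
(* The constant [s * c] is always feasible at [s *: y], so failure of linearity can only be a strict
   drop. *)
have bsc : b < s * c.
  rewrite lt_neqAle; apply/andP; split.
    by apply/eqP => bsc; apply: ns; rewrite bE bsc.
  rewrite -lee_fin -bE; apply: polar_le; split=> [|x].
    by rewrite mulr_ge0//; case/andP: s01.
  by rewrite dotpZr; have := fc x; nra.
have s0 : 0 < s.
  rewrite lt_def; case/andP: s01 => -> _; rewrite andbT; apply/eqP => s0.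
  by move: bsc; rewrite s0 mul0r ltNge b0.
(* Thus [b / s + e] is the midpoint of [b / s] and [c], still below [c]. *)
pose e := (c - b / s) / 2.
have bs : b / s < c by rewrite ltr_pdivrMr// mulrC.
have e0 : 0 < e by rewrite divr_gt0// subr_gt0.
have [m m0 fm] := S1_growth.
(* Dividing the inequality at [s *: y] by [s] leaves [s^-1] in place of 1; beyond [M], the growth of
   [e * f x] absorbs the excess. *)
pose M := Num.max 1 ((s^-1 - 1) / (e * m)).
have [c1 [c10 fc1 c1max]] := S1_feasible_on_ball y M.
have bs0 : 0 <= b / s by rewrite divr_ge0// ltW.
have far x : M <= `|x| -> dotp x y <= 1 + (b / s + e) * f x.
  rewrite ge_max => /andP[x1]; rewrite ler_pdivrMr ?(mulr_gt0 e0 m0)// => xM.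
  have := fb x; rewrite dotpZr -ler_pdivlMl// mulrDr mulr1 mulrA (mulrC _ b).
  move=> /le_trans; apply; rewrite mulrDl addrCA [leRHS]addrC -addrA.
  have := fm x x1; rewrite -(ler_pM2l e0); lra.
(* The larger of [b / s + e] and [c1] is feasible everywhere, hence at least [c], and the first of
   them is not. *)
have cc1 : c <= c1.
  have : polar_feasible f y (Num.max (b / s + e) c1).
    split=> [|x]; first by rewrite le_max c10 orbT.
    have [xM|/ltW xM] := leP `|x| M.
      rewrite (le_trans (fc1 x xM))// lerD2l ler_wpM2r ?S1_ge0//.
      by rewrite le_max lexx orbT.
    by rewrite (le_trans (far x xM))// lerD2l ler_wpM2r ?S1_ge0// le_max lexx.
  move=> /polar_le; rewrite cE lee_fin le_max => /orP[|//].
  by rewrite /e; lra.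
case: c1max => [c1_eq0|[x x0 xc1]].
  by exfalso; move: cc1 bs bs0; rewrite c1_eq0; lra.
have fx0 := S1_gt0 x0.
have cE1 : c = c1.
  by apply/le_anti; rewrite cc1/= -(ler_pM2r fx0) -xc1 lerBlDl fc.
exists x, c; split=> //; last by rewrite cE1.
by rewrite (le_lt_trans bs0).
Qed.

(** Between two maximizers, feasibility bounds [f] below by its affine interpolation and convexity
    bounds it above, so the graph would contain a segment. *)
Lemma S1_maximizer_unique y c x z : 0 < c -> polar_feasible f y c ->
  dotp x y - 1 = c * f x -> dotp z y - 1 = c * f z -> x = z.
Proof.
move=> c0 [_ fc] xc zc; apply: contrapT => /S1_no_affine_segment; apply=> s s01.
apply/le_anti; rewrite S1_convex//= -(ler_pM2l c0).
have := fc (s *: x + (1 - s) *: z); rewrite dotpDl !dotpZl.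
have -> : dotp x y = 1 + c * f x by rewrite -xc addrC subrK.
have -> : dotp z y = 1 + c * f z by rewrite -zc addrC subrK.
lra.
Qed.

Lemma S1_tangent x z : x != 0 -> f x + 'd f x (z - x) <= f z.
Proof.
move=> x0; rewrite -lerBrDl -deriveE; last exact: S1_differentiable.
have dfx : derivable f x (z - x) by exact/diff_derivable/S1_differentiable.
(* For steps [h] in (0, 1], convexity bounds the difference quotient by [f z - f x]. *)
rewrite /derive cvg_at_rightE//; apply: limr_le.
  by apply/cvg_ex; eexists; exact: cvg_dnbhs_at_right dfx.
near=> h => /=.
have h0 : 0 < h by near: h; exact: nbhs_right_gt.
have h1 : h <= 1 by near: h; exact: nbhs_right_le.
rewrite /GRing.scale /= ler_pdivrMl//.
have -> : h *: (z - x) + x = h *: z + (1 - h) *: x.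
  by rewrite scalerBr scalerBl scale1r -!addrA (addrC x).
have := @S1_convex h z x; rewrite h1 ltW// => /(_ isT); lra.
Unshelve. all: by end_near. Qed.

(** Equality would make the tangent at [x] pass through the origin, and [f] would be linear on the
    segment from 0 to [x]. *)
Lemma S1_diff_gt x : x != 0 -> f x < 'd f x x.
Proof.
move=> x0; rewrite lt_neqAle; apply/andP; split; last first.
  have := S1_tangent 0 x0; rewrite S1_at0 sub0r linearN; lra.
apply/eqP => fxE; apply: (@S1_no_affine_segment x 0); first exact/eqP.
move=> s s01; rewrite scaler0 addr0 S1_at0 mulr0 addr0.
apply/le_anti; rewrite S1_scale//=.
have := S1_tangent (s *: x) x0; rewrite linearB linearZ /= -fxE.
by rewrite /GRing.scale /=; lra.
Qed.

(** For [x != 0], the tangent at [x] yields a [y] whose polar value is attained at [x]. The equality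
    case is symmetric in [x] and [y], so [y] in turn certifies the value of the bipolar at [x]. *)
Lemma S1_polarK : polar (polar (fun x => (f x)%:E)) = (fun x => (f x)%:E).
Proof.
pose g y := fine (polar (fun x => (f x)%:E) y).
have gE : polar (fun x => (f x)%:E) = (fun y => (g y)%:E).
  by apply/funext => y; rewrite /g; have [c ->] := S1_polar_fin y.
have feas_g y : polar_feasible f y (g y).
  by apply: polar_feasibleP; [exact: S1_ge0|rewrite gE].
rewrite gE; apply/funext => x.
have [->|x0] := eqVneq x 0; first by rewrite polar_at0 S1_at0.
pose a := 'd f x x - f x; have a0 : 0 < a by rewrite subr_gt0 S1_diff_gt.
(* The gradient is divided by [a], the negated height of the tangent at 0, so that
   [dotp x y - 1 = a^-1 * f x]. *)
pose y := a^-1 *: \row_i 'd f x (delta_mx 0 i).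
have dotE z : dotp z y = a^-1 * 'd f x z.
  rewrite dotpZr [in RHS](row_sum_delta z) linear_sum; congr (_ * _).
  by apply: eq_bigr => i _; rewrite mxE linearZ.
have gy : g y = a^-1.
  rewrite /g (@polar_attained_eq _ _ f y a^-1 x)//; last 2 first.
  - exact: S1_gt0.
  - by rewrite dotE -(mulVf (lt0r_neq0 a0)) -mulrBr subKr.
  split=> [|z]; first by rewrite invr_ge0 ltW.
  rewrite dotE -(mulVf (lt0r_neq0 a0)) -mulrDr ler_pM2l ?invr_gt0//.
  have := S1_tangent z x0; rewrite linearB /a; lra.
apply: (@polar_attained_eq _ _ g x (f x) y).
- split=> [|z]; first exact: S1_ge0.
  by rewrite dotpC mulrC; case: (feas_g z).
- by rewrite gy invr_gt0.
- rewrite dotpC dotE gy -(mulVf (lt0r_neq0 a0)) -mulrBr subKr.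
  exact: mulrC.
Qed.

(** Bipolarity turns membership in the polar subdifferential into the equation of a maximizer, and
    maximizers are unique. *)
Lemma S1_polar_subdiff y c x : 0 < c -> polar (fun x => (f x)%:E) y = c%:E ->
  dotp x y - 1 = c * f x ->
  polar_subdiff (polar (fun x => (f x)%:E)) y = [set x].
Proof.
move=> c0 cE xc; have fc := polar_feasibleP S1_ge0 cE.
rewrite /polar_subdiff S1_polarK cE; apply/seteqP; split=> z /=.
  move=> [_]; rewrite -EFinM => -[zc]; apply: (S1_maximizer_unique c0 fc) => //.
  by rewrite dotpC -zc mulrC.
by move=> ->; split; [exact: ltry|rewrite -EFinM mulrC dotpC xc].
Qed.

(* By concavity of [x |-> <x,y> - 1 - c * f x], a maximum of the quotient over a
   ball that is not on the boundary sphere is global. *)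
Lemma S1_polar_attained_ball y x0 (r : R) : 0 <= r < `|x0| -> 1 < dotp x0 y ->
  (forall x, `|x - x0| = r ->
     (dotp x y - 1) / f x < (dotp x0 y - 1) / f x0) ->
  exists x c, [/\ `|x - x0| <= r, 0 < c,
    polar (fun x => (f x)%:E) y = c%:E & dotp x y - 1 = c * f x].
Proof.
move=> /andP[r0 rx0] x0y sphere; pose K := [set x | 0 <= `|x - x0| <= r].
pose q x := (dotp x y - 1) / f x.
have K_neq0 x : K x -> x != 0.
  move=> /= /andP[_ xr]; apply/eqP => x_eq0.
  by move: xr; rewrite x_eq0 sub0r normrN leNgt rx0.
have Kx0 : K x0 by rewrite /K /= subrr normr0 lexx.
have [|x1 /set_mem Kx1 x1max] :=
    EVT_max_rV (ex_intro _ _ Kx0) (@compact_annulus_at R n x0 0 r) (f := q).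
  apply: continuous_in_subspaceT => x /set_mem /K_neq0.
  exact: S1_quotient_continuous.
have fx1 : 0 < f x1 by exact/S1_gt0/K_neq0.
pose c := q x1; have xc : dotp x1 y - 1 = c * f x1 by rewrite divfK ?gt_eqF.
have c0 : 0 < c.
  rewrite (@lt_le_trans _ _ (q x0))//; last by apply: x1max; rewrite inE.
  by rewrite divr_gt0 ?subr_gt0// S1_gt0// K_neq0.
have x1r : `|x1 - x0| < r.
  rewrite lt_neqAle; case/andP: (Kx1) => _ ->; rewrite andbT.
  apply/eqP => /sphere.
  by rewrite ltNge => /negP; apply; apply: x1max; rewrite inE.
exists x1, c; split=> //; first exact: ltW.
apply: (polar_attained_eq _ fx1 xc); split=> [|z]; first exact: ltW.
pose d := r - `|x1 - x0|; have d0 : 0 < d by rewrite subr_gt0.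
(* Moving from [x1] towards [z] by the fraction [e] costs at most [d], so it stays in the ball; the
   summand [d] below keeps [e] at most 1. *)
pose e := d / (d + `|z - x1|).
have dz0 : 0 < d + `|z - x1| by rewrite ltr_wpDr.
have e0 : 0 < e by rewrite divr_gt0.
have e1 : e <= 1 by rewrite ler_pdivrMr// mul1r lerDl.
have Kz : K (e *: z + (1 - e) *: x1).
  rewrite /K /= normr_ge0/=.
  have -> : e *: z + (1 - e) *: x1 - x0 = e *: (z - x1) + (x1 - x0).
    by rewrite scalerBr scalerBl scale1r !addrA; congr (_ - _); rewrite addrAC.
  rewrite (le_trans (ler_normD _ _))// -lerBrDr normrZ gtr0_norm//.
  by rewrite -/d mulrAC ler_pdivrMr// ler_pM2l// lerDr ltW.
have : q (e *: z + (1 - e) *: x1) <= c by apply: x1max; rewrite inE.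
rewrite ler_pdivrMr; last exact/S1_gt0/K_neq0.
have e01 : 0 <= e <= 1 by rewrite e1 ltW.
have := S1_convex z x1 e01; rewrite -(ler_pM2l c0) dotpDl !dotpZl => h1 h2.
have h3 : dotp x1 y = 1 + c * f x1 by rewrite -xc addrC subrK.
rewrite -(ler_pM2l e0); rewrite h3 in h2; lra.
Qed.

End S1Theory.

(** * Derivatives through first-order error bounds *)

Section RealDerivatives.
Context {R : realType}.
Implicit Types (g dg : R -> R) (s t l e d : R).

Lemma is_derive_near g t l :
  (forall e, 0 < e -> \forall s \near t,
     `|g s - g t - (s - t) * l| <= e * `|s - t|) ->
  is_derive t 1 g l.
Proof.
move=> est.
suff gl : h^-1 *: ((g \o shift t) (h *: 1) - g t) @[h --> 0^'] --> l.
  by apply: DeriveDef; [apply/cvg_ex; exists l|exact/cvg_lim].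
apply/cvgrPdist_le => e e0.
have {}est : \forall h \near 0, `|g (h + t) - g t - h * l| <= e * `|h|.
  have := est e e0; rewrite (near_shift 0) /=.
  by apply: filterS => h; rewrite /= subr0 addrK.
rewrite near_withinE; near=> h => h0.
rewrite /= /GRing.scale /= mulr1 distrC -(ler_pM2l (_ : 0 < `|h|)) ?normr_gt0//.
rewrite -normrM mulrBr mulrA divff// mul1r (mulrC _ e).
by near: h.
Unshelve. all: by end_near. Qed.

(** By the mean value theorem. The bound sees [g] only through [d], [e] and [l], hence is uniform
    over a family of functions sharing them. *)
Lemma increment_bound g dg t d e l :
  (forall s, `|s - t| < d -> is_derive s 1 g (dg s)) ->
  (forall s, `|s - t| < d -> `|dg s - l| <= e) ->
  forall s, `|s - t| < d -> `|g s - g t - (s - t) * l| <= e * `|s - t|.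
Proof.
move=> g_dg dgl s sd.
have aux a b : `|a - t| < d -> `|b - t| < d -> a <= b ->
    `|g b - g a - (b - a) * l| <= e * `|b - a|.
  move=> ad bd ab.
  have itvd z : z \in `[a, b] -> `|z - t| < d.
    move: ad bd; rewrite in_itv /= !ltr_norml.
    move=> /andP[? ?] /andP[? ?] /andP[? ?].
    by apply/andP; split; lra.
  have [z||z zab ->] := MVT_segment (f := g) (df := dg) ab.
  - by move=> zab; apply/g_dg/itvd; exact: subset_itv_oo_cc zab.
  - by apply: derivable_within_continuous => z /itvd /g_dg [].
  by rewrite mulrC -mulrBr normrM mulrC ler_wpM2r// dgl// itvd.
have td : `|t - t| < d by rewrite subrr normr0 (le_lt_trans _ sd).
have [ts|/ltW st] := leP t s; first exact: aux.
have := aux s t sd td st; rewrite (distrC t) -[X in X <= _]normrN.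
by congr (`|_| <= _); ring.
Qed.

End RealDerivatives.

(** * Joint regularity in time and space *)

Section Variation.
Context {R : realType} {n : nat} {u : R -> 'rV[R]_n -> R}.
Hypothesis u_C1 : C_on 1 [set z : R * 'rV[R]_n | z.2 != 0] (fun z => u z.1 z.2).
Hypothesis u_S1 : forall t, S1 (fun x => (u t x)%:E).
Implicit Types (s t : R) (x y : 'rV[R]_n).

Local Notation ut := ('D_((1, 0) : R * 'rV[R]_n) (fun z => u z.1 z.2)).

Lemma joint_continuous s x : x != 0 ->
  {for (s, x), continuous (fun z : R * 'rV[R]_n => u z.1 z.2)}.
Proof.
by case: u_C1 => du _ x0; apply: differentiable_continuous; exact: du.
Qed.

Lemma time_derivative_continuous s x : x != 0 -> {for (s, x), continuous ut}.
Proof. by case: u_C1 => _ cu x0; exact: cu. Qed.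

Lemma is_derive_time s x : x != 0 -> is_derive s 1 (u ^~ x) (ut (s, x)).
Proof.
case: u_C1 => du _ x0.
have dU : derivable (fun z => u z.1 z.2) (s, x) ((1, 0) : R * 'rV[R]_n).
  by apply: diff_derivable; exact: du.
have slice : (fun h : R => h^-1 *: ((u ^~ x \o shift s) (h *: 1) - u s x)) =
    (fun h : R => h^-1 *: (((fun z => u z.1 z.2) \o shift (s, x))
       (h *: ((1, 0) : R * 'rV[R]_n)) - u s x)).
  by apply/funext => h; rewrite /= scaler0 add0r.
by apply: DeriveDef; rewrite /derivable /derive slice.
Qed.

Lemma is_derive_ln_time s x : x != 0 ->
  is_derive s 1 (fun s => ln (u s x)) ((u s x)^-1 * ut (s, x)).
Proof.
move=> x0; apply: is_derive1_comp; last exact: is_derive_time.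
by apply: is_derive1_ln; exact: S1_gt0 (u_S1 s) _ x0.
Qed.

Lemma ln_time_derivative_continuous s x : x != 0 ->
  {for (s, x), continuous (fun z => (u z.1 z.2)^-1 * ut z)}.
Proof.
move=> x0; apply: (@continuousM _ _ (fun z => (u z.1 z.2)^-1) ut (s, x)).
  apply: (@continuousV _ _ (fun z => u z.1 z.2) (s, x)).
    by rewrite gt_eqF// (S1_gt0 (u_S1 s)).
  exact: joint_continuous.
exact: time_derivative_continuous.
Qed.

Lemma quotient_continuous y s x : x != 0 ->
  {for (x, s), continuous
     (fun z : 'rV[R]_n * R => (dotp z.1 y - 1) / u z.2 z.1)}.
Proof.
move=> x0; apply: (@continuousM _ _ (fun z => dotp z.1 y - 1)
                     (fun z => (u z.2 z.1)^-1) (x, s)).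
  apply: (@continuousB _ _ _ (fun z => dotp z.1 y) (cst 1) (x, s)).
    apply: (@continuous_comp _ _ _ fst (fun z => dotp z y)).
      exact: cvg_fst.
    exact: dotp_continuous.
  exact: cst_continuous.
apply: (@continuousV _ _ (fun z => u z.2 z.1) (x, s)).
  by rewrite gt_eqF// (S1_gt0 (u_S1 s)).
apply: (@continuous_comp _ _ _ (fun z : 'rV[R]_n * R => (z.2, z.1))
          (fun z : R * 'rV[R]_n => u z.1 z.2) (x, s)).
  exact: (cvg_pair cvg_snd cvg_fst).
exact: joint_continuous.
Qed.

(** The gap between the two quotients is jointly continuous and positive at time [t] along the
    sphere, which avoids 0; compactness makes one neighbourhood of [t] serve all its points. *)
Lemma near_lt_on_sphere y t x0 (r : R) : 0 <= r < `|x0| ->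
  (forall x, `|x - x0| = r ->
     (dotp x y - 1) / u t x < (dotp x0 y - 1) / u t x0) ->
  \forall s \near t, forall x, `|x - x0| = r ->
     (dotp x y - 1) / u s x < (dotp x0 y - 1) / u s x0.
Proof.
move=> /andP[r0 rx0] sphere.
have x0_neq0 : x0 != 0 by rewrite -normr_gt0 (le_lt_trans r0).
pose q (z : 'rV[R]_n * R) := (dotp z.1 y - 1) / u z.2 z.1.
have : \forall s \near t, [set x | r <= `|x - x0| <= r] `<=`
    [set x | 0 < q (x0, s) - q (x, s)].
  have /compact_near_coveringP cover := @compact_annulus_at R n x0 r r.
  apply: (cover R (nbhs t) (fun s => [set x | 0 < q (x0, s) - q (x, s)]) _).
  move=> x /= /le_anti/esym xr.
  have x_neq0 : x != 0.
    apply/eqP => x_eq0; move: xr rx0; rewrite x_eq0 sub0r normrN => ->.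
    by rewrite ltxx.
  have qc : q (x0, z.2) - q z @[z --> (x, t)] --> q (x0, t) - q (x, t).
    apply: (@continuousB _ _ _ (fun z => q (x0, z.2)) q (x, t)).
      apply: (@continuous_comp _ _ _
                (fun z : 'rV[R]_n * R => (x0, z.2)) q (x, t)).
        exact: (@cvg_pair _ _ _ (nbhs (x, t)) (nbhs x0) (nbhs t) _ _ _
                  (cst x0) snd (cvg_cst _) cvg_snd).
      exact: quotient_continuous.
    exact: quotient_continuous.
  have q0 : 0 < q (x0, t) - q (x, t) by rewrite subr_gt0 sphere.
  by apply: filterS (cvgr_gt _ qc _ q0) => -[].
apply: filterS => s lt_s x xr.
by rewrite -subr_gt0; apply: (lt_s x); rewrite /= xr lexx.
Qed.

End Variation.

(** * Envelope argument for the logarithm of the polar *)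

Theorem proposition5p2 (R : realType) (n : nat)
    (u : R -> 'rV[R]_n -> R) (w : R -> 'rV[R]_n -> \bar R)
    (u_C2 : C_on 2 [set z : R * 'rV[R]_n | z.2 != 0] (fun z => u z.1 z.2))
    (u_S2 : forall t, S2 (fun x => (u t x)%:E))
    (wE : forall t, w t = polar (fun x => (u t x)%:E))
    (t : R) (y : 'rV[R]_n) (w_nonlin : ~ linear_on_segment (w t) y) :
  [/\ polar_differentiable (w t) y,
      forall s, (0 < w s y < +oo)%E,
      forall s, 0 < u s (polar_gradient (w t) y),
      derivable (fun s => ln (u s (polar_gradient (w t) y))) t 1 &
      is_derive t 1 (fun s => ln (fine (w s y)))
        (- 'D_1 (fun s => ln (u s (polar_gradient (w t) y))) t)].
Proof.
have u_S1 s : S1 (fun x => (u s x)%:E) by case: (u_S2 s).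
have u_C1 : C_on 1 [set z : R * 'rV[R]_n | z.2 != 0] (fun z => u z.1 z.2).
  case: u_C2 => du d2u; split=> // v z z0.
  by case: (d2u v) => /(_ z z0) /differentiable_continuous.
have y0 : y != 0.
  apply/eqP => y_eq0; apply: w_nonlin; rewrite y_eq0 wE.
  by split=> [|s _]; rewrite ?scaler0 polar_at0// mule0.
have [x0 [c [x0_neq0 c0 wty [_ feas_c] x0c]]] :
    exists x c, [/\ x != 0, 0 < c, w t y = c%:E, polar_feasible (u t) y c &
      dotp x y - 1 = c * u t x].
  by have := S1_polar_attained (u_S1 t); rewrite -wE; apply.
have subdiffE : polar_subdiff (w t) y = [set x0].
  by move: wty; rewrite wE => /(S1_polar_subdiff (u_S1 t) c0); apply.
have -> : polar_gradient (w t) y = x0.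
  by apply: xget_unique; rewrite subdiffE.
have u_gt0 s x : x != 0 -> 0 < u s x by exact: S1_gt0 (u_S1 s) x.
have ln_u s x x_neq0 := is_derive_ln_time u_C1 u_S1 s (x := x) x_neq0.
pose l z := (u z.1 z.2)^-1 * 'D_((1, 0) : R * 'rV[R]_n) (fun z => u z.1 z.2) z.
split.
- by split; [rewrite /dom /= wty ltry|exists x0].
- move=> s; rewrite wE (S1_polar_gt0 (u_S1 s) y0).
  by have [b ->] := S1_polar_fin (u_S1 s) y; rewrite ltry.
- by move=> s; exact: u_gt0.
- by case: (ln_u t x0 x0_neq0).
rewrite (@derive_val _ _ _ _ _ _ _ (ln_u t x0 x0_neq0)) -/(l (t, x0)).
apply: is_derive_near => e e0.
have /cvgrPdist_le /(_ e e0) :=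
  ln_time_derivative_continuous u_C1 u_S1 (s := t) x0_neq0.
move=> /nbhs_ballP [d /= d0 near_l].
(* The ball of radius [r] around [x0] lies where [l] is within [e] of [l (t, x0)], and it avoids the
   origin. *)
pose r := Num.min (d / 2) (`|x0| / 2).
have r0 : 0 < r by rewrite lt_min !divr_gt0// normr_gt0.
have rd : r < d.
  by rewrite gt_min; apply/orP; left; lra.
have rx0 : r < `|x0|.
  by move: x0_neq0; rewrite -normr_gt0 gt_min => ?; apply/orP; right; lra.
(* Uniformity in [x] matters: the bound will be used at a maximizer that moves with [s]. *)
have ln_bound s x : `|s - t| < d -> `|x - x0| <= r ->
    `|ln (u s x) - ln (u t x) - (s - t) * l (t, x0)| <= e * `|s - t|.
  move=> sd xr; have x_neq0 : x != 0.
    by apply/eqP => x_eq0; move: xr; rewrite x_eq0 sub0r normrN leNgt rx0.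
  apply: (@increment_bound _ (fun s => ln (u s x)) (fun s => l (s, x)) t d)
    => // a ad.
    exact: ln_u.
  rewrite distrC; apply: near_l; split; rewrite -ball_normE /= distrC//.
  exact: le_lt_trans rd.
have x0y : 0 < dotp x0 y - 1 by rewrite x0c mulr_gt0// u_gt0.
have sphere_t x : `|x - x0| = r ->
    (dotp x y - 1) / u t x < (dotp x0 y - 1) / u t x0.
  move=> xr; have x_neq0 : x != 0.
    apply/eqP => x_eq0; move: xr rx0; rewrite x_eq0 sub0r normrN => ->.
    by rewrite ltxx.
  rewrite x0c mulfK ?gt_eqF ?u_gt0// ltr_pdivrMr ?u_gt0// lt_neqAle.
  rewrite lerBlDl feas_c andbT; apply/eqP => xc.
  have xx0 := S1_maximizer_unique (u_S1 t) c0 (conj (ltW c0) feas_c) xc x0c.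
  by move: r0; rewrite -xr xx0 subrr normr0 ltxx.
have r_bounds : 0 <= r < `|x0| by rewrite ltW.
have sphere := near_lt_on_sphere u_C1 u_S1 r_bounds sphere_t.
have td : \forall s \near t, `|s - t| < d.
  by apply/nbhs_ballP; exists d => // s; rewrite -ball_normE /= distrC.
apply: filterS2 sphere td => s sphere_s sd.
have [||x1 [c1 [x1r c10 wsy x1c]]] :=
    S1_polar_attained_ball (u_S1 s) (y := y) (x0 := x0) (r := r) _ _ sphere_s.
- by rewrite ltW.
- by rewrite -subr_gt0.
have [_ feas_c1] := polar_feasibleP (S1_ge0 (u_S1 s)) wsy.
have x1_neq0 : x1 != 0.
  by apply/eqP => x1_eq0; move: x1r; rewrite x1_eq0 sub0r normrN leNgt rx0.
(* Each maximizer is tested against the optimal constant of the other time: [x0] against [c1] here,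
   [x1] against [c] next. *)
have lower : ln c + ln (u t x0) <= ln c1 + ln (u s x0).
  rewrite -!lnM ?posrE ?u_gt0// ler_ln ?posrE ?mulr_gt0 ?u_gt0//.
  by rewrite -x0c lerBlDl feas_c1.
have upper : ln c1 + ln (u s x1) <= ln c + ln (u t x1).
  rewrite -!lnM ?posrE ?u_gt0// ler_ln ?posrE ?mulr_gt0 ?u_gt0//.
  by rewrite -x1c lerBlDl feas_c.
have := ln_bound s x0 sd; rewrite subrr normr0 ltW// => /(_ isT).
have := ln_bound s x1 sd x1r.
rewrite wE wsy wty /= !ler_norml => /andP[? ?] /andP[? ?].
by apply/andP; split; lra.
Qed.
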